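(* Let $f:\mathbb{R}\to\mathbb{R}$ be a Lebesgue measurable function. Then $f$ satisfies $$f(\alpha+\beta)=\frac{f(\alpha+\delta)}{f(\delta)}\cdot f(\beta)+\frac{f(\delta-\beta)}{f(\delta)}\cdot f(\alpha)\quad\text{for all }\alpha,\beta\in\mathbb{R}\text{ and all }\delta\in\mathbb{R}\setminus f^{-1}(0)$$ if and only if $f\in\mathcal{S}$, where $\mathcal{S}=\{c\cdot s_k:\ c,k\in\mathbb{R}\}$.
   Context: For $k\in\mathbb{R}$ the function $s_k:\mathbb{R}\to\mathbb{R}$ is defined by $s_k(x)=\frac{\sin(\sqrt{k}\,x)}{\sqrt{k}}$ if $k>0$, $s_k(x)=x$ if $k=0$, and $s_k(x)=\frac{\sinh(\sqrt{-k}\,x)}{\sqrt{-k}}$ if $k<0$. Here $f^{-1}(0)$ is the zero set of $f$. *)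

(* Defs.v *)
From HB Require Import structures.
From mathcomp Require Import all_boot all_order all_algebra.
From mathcomp Require Import all_classical all_reals all_analysis.
From mathcomp Require Import measurable_realfun.
Set Implicit Arguments.
Unset Strict Implicit.
Unset Printing Implicit Defensive.
Import Order.TTheory GRing.Theory Num.Theory.
Import numFieldNormedType.Exports.
Local Open Scope classical_set_scope.
Local Open Scope ring_scope.

(* The canonical sigma-algebra on R is the Borel one. Lebesgue measurability of
   a function uses its completion on the domain (the sets A `|` N with A Borel
   and N contained in a Borel null set) and the Borel sets on the codomain. *)
Definition lebesgue_measurable_fun (R : realType) (f : R -> R) : Prop :=
  @measurable_fun _ _
    (g_sigma_algebraType (completed_algebra_gen (@lebesgue_measure R)))
    (measurableTypeR R) setT f.

Definition sinh (R : realType) (x : R) : R := (expR x - expR (- x)) / 2.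

Definition s (R : realType) (k x : R) : R :=
  if 0 < k then sin (Num.sqrt k * x) / Num.sqrt k
  else if k == 0 then x
  else sinh (Num.sqrt (- k) * x) / Num.sqrt (- k).

Definition calS (R : realType) : set (R -> R) :=
  [set f | exists c k : R, f = fun x => c * s k x].

(* Main.v *)
Require Import Defs.
From mathcomp Require Import all_boot all_order all_algebra.
From mathcomp Require Import all_classical all_reals all_analysis.
From mathcomp Require Import measurable_realfun.
From mathcomp Require Import ring lra.
Import Order.TTheory GRing.Theory Num.Theory.
Import numFieldNormedType.Exports.
Local Open Scope classical_set_scope.
Local Open Scope ring_scope.

(** Let [f d <> 0]. The equation forces [f] to be odd, and with
    [g a = (f (d + a) + f (d - a)) / (2 f d)] it turns into the addition
    formulas [f (a + b) = f a g b + g a f b] and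
    [g (a + b) = g a g b + kap f a f b].  For regularity, choose a non-null set
    on which [f] and [f (d + _)] are bounded and oscillate little; its
    differences fill a neighbourhood of 0 (Steinhaus), and
    [f (x - y) f d = f (d + y) f x - f (d + x) f y] shows that [f] tends to 0
    at 0, hence is continuous.  If [F] is a primitive of [f], integrating
    [f (b + a) + f (b - a) = 2 f b g a] over [a] in [0, t] expresses [f b] as a
    multiple of [F (b + t) - F (b - t)], so [f] is differentiable.  Then
    [f' = c g] and [g' = kap c f], a linear system solved by [c s_k] for
    [k = - kap c^2]. *)

(** * Lebesgue measure: translation invariance, Steinhaus, small oscillation *)

Section measure.
Context {R : realType}.
Local Notation mu := (@lebesgue_measure R).

Lemma measurable_addr (c : R) :
  measurable_fun setT (+%R c : measurableTypeR R -> measurableTypeR R).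
Proof. exact: measurable_funD. Qed.

(** The pushforward of [mu] under a translation agrees with [mu] on half-open intervals, and these
    determine the measure. *)
Lemma lebesgue_measureD (c : R) (A : set R) : measurable A ->
  mu (+%R c @^-1` A) = mu A.
Proof.
move=> mA; apply/esym.
rewrite [LHS](@lebesgue_measure_unique R (pushforward mu
  (+%R c : measurableTypeR R -> measurableTypeR R)))//.
  exact: measurable_addr.
move=> ? _ [[a b]] _ <-.
have E : +%R c @^-1` `]a, b] = `]a - c, b - c]%classic.
  by apply/seteqP; split=> x /=; rewrite !in_itv/= ltrBlDl lerBrDl.
rewrite [RHS](_ : _ = mu `]a - c, b - c]%classic); last by rewrite -E.
by rewrite !lebesgue_measure_itv/= !lte_fin ltrBlDr subrK -!EFinD opprB addrA subrK.
Qed.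

Lemma compact_lebesgue_measure_lty (K : set R) : compact K -> (mu K < +oo)%E.
Proof.
move=> /compact_bounded [M [_ /(_ (M + 1))]]; rewrite ltrDl ltr01 => /(_ isT) KM.
apply: (@le_lt_trans _ _ (mu `[- (M + 1), M + 1]%classic)).
  by apply: le_outer_measure => x /KM /=; rewrite in_itv/= ler_norml.
by rewrite lebesgue_measure_itv/=; case: ifP => _; rewrite -?EFinD ?ltry.
Qed.

(** Take [K] compact in [P] with positive measure and [U] open around [K] with [mu (U \ K) < mu K].
    A small translate of [K] stays in [U]; were it disjoint from [P], it would fit into [U \ K],
    which is too small. *)
Lemma steinhaus (P : set R) : measurable P -> (0 < mu P)%E ->
  \forall h \near (0 : R), exists2 x, P x & P (h + x).
Proof.
move=> mP; rewrite lebesgue_regularity_inner_sup// => /ereal_sup_gt[_ [K [cK KP] <-] K0].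
have mK : measurable K by apply: closed_measurable; exact: compact_closed.
have Koo := compact_lebesgue_measure_lty _ cK.
have fK : mu K \is a fin_num by rewrite ge0_fin_numE.
have fK0 : 0 < fine (mu K) by rewrite fine_gt0// K0 Koo.
have [U [oU KU]] := lebesgue_regularity_outer mK Koo fK0; rewrite fineK// => UK.
(* Compactness makes the admissible [h] uniform over the points of [K]. *)
have KhU : \forall h \near (0 : R), K `<=` [set x | U (h + x)].
  have /compact_near_coveringP cov := cK.
  apply: (cov R (nbhs (0 : R)) (fun h x => U (h + x))) => x Kx.
  have /= : {for (x, 0 : R), continuous (fun z : R * R => z.2 + z.1)}.
    by move=> z; apply: cvgD; [exact: cvg_snd|exact: cvg_fst].
  move=> /(_ U); apply; rewrite /= add0r; apply: open_nbhs_nbhs; split=> //.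
  exact: KU.
apply: filterS KhU => h KhU.
apply: contrapT => /forall2NP Ph.
suff : (mu K <= mu (U `\` K))%E by rewrite leNgt UK.
have mUK : measurable (U `\` K) by apply: measurableD => //; exact: open_measurable.
rewrite -(lebesgue_measureD h _ mUK).
apply: le_outer_measure => x Kx /=; split; first exact: KhU.
by move=> /KP Phx; case: (Ph x) => //; apply; exact: KP.
Qed.

(** Countably many level sets of height [e] cover [P], each a Borel set up to a negligible one. If
    every Borel part met [P] in a null set, [P] would be null. *)
Lemma lebesgue_measurable_oscillation (f : R -> R) (P : set R) (e : R) :
  lebesgue_measurable_fun f -> measurable P -> (0 < mu P)%E -> 0 < e ->
  exists Q : set R, [/\ measurable Q, Q `<=` P, (0 < mu Q)%E &
    forall x y, Q x -> Q y -> `|f x - f y| <= e].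
Proof.
move=> mf mP P0 e0.
(* Levels are numbered by the codes of integers; a number that codes no integer gets the empty
   level. *)
pose level n : set R :=
  if unpickle n is Some z then `[z%:~R * e, (z + 1)%:~R * e]%classic else set0.
have mlevel n : exists AN : set R * set R,
    [/\ measurable AN.1, mu.-negligible AN.2 & AN.1 `|` AN.2 = f @^-1` level n].
  have := mf measurableT (level n); rewrite setTI => /(_ _).
  have mln : measurable (level n).
    by rewrite /level; case: unpickle => // z; exact: measurable_itv.
  move=> /(_ mln).
  move=> mfl.
  have : (completed_algebra_gen mu).-sigma.-measurable (f @^-1` level n).
    exact: mfl.
  rewrite g_sigma_completed_algebra_genE => -[A mA [N nN] <-].
  by exists (A, N).
have [AN ANP] := choice mlevel.
apply: contrapT => noQ.
have PA0 n : mu.-negligible (P `&` (AN n).1).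
  have [mA _ AE] := ANP n.
  have mPA : measurable (P `&` (AN n).1) by exact: measurableI.
  apply/negligibleP => //; apply/eqP; rewrite eq_le measure_ge0 andbT leNgt.
  apply/negP => PA0; apply: noQ; exists (P `&` (AN n).1); split=> //.
  move=> x y [_ Ax] [_ Ay].
  have : level n (f x) by have : (f @^-1` level n) x by rewrite -AE; left.
  have : level n (f y) by have : (f @^-1` level n) y by rewrite -AE; left.
  rewrite /level; case: unpickle => // z /=; rewrite !in_itv/= intrD.
  move=> /andP[? ?] /andP[? ?]; rewrite ler_norml; lra.
suff : mu.-negligible P.
  move=> nP; have P00 : mu P = 0%E := proj1 (negligibleP mu mP) nP.
  by move: P0; rewrite P00 ltxx.
have : mu.-negligible (\bigcup_n (P `&` (AN n).1 `|` (AN n).2)).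
  apply: negligible_bigcup => n; apply: negligibleU => //.
  by have [] := ANP n.
apply: negligibleS => x Px.
pose z := Num.floor (f x / e).
exists (pickle z) => //.
have [_ _ AE] := ANP (pickle z).
have : (f @^-1` level (pickle z)) x.
  rewrite /level pickleK /= in_itv/= -ler_pdivlMr// ge_floor/=.
  by rewrite -ler_pdivrMr// ltW// floorD1_gt.
by rewrite -AE => -[]; [left|right].
Qed.
End measure.

(** * The model functions: [s k], its derivative [co k], their identities *)

Section model.
Context {R : realType}.
Implicit Types k x y : R.

Definition cosh x : R := (expR x + expR (- x)) / 2.

Definition co k x : R :=
  if 0 < k then cos (Num.sqrt k * x)
  else if k == 0 then 1 else cosh (Num.sqrt (- k) * x).

Lemma sinhD x y : sinh (x + y) = sinh x * cosh y + cosh x * sinh y.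
Proof. by rewrite /sinh /cosh opprD !expRD; field. Qed.

Lemma sinhN x : sinh (- x) = - sinh x.
Proof. by rewrite /sinh opprK -mulNr opprB. Qed.

Lemma coshN x : cosh (- x) = cosh x.
Proof. by rewrite /cosh opprK addrC. Qed.

Lemma cosh2Bsinh2 x : cosh x ^+ 2 - sinh x ^+ 2 = 1.
Proof.
have : expR x * expR (- x) = 1 by rewrite -expRD subrr expR0.
by move=> e; rewrite -[RHS]e /sinh /cosh; field.
Qed.

Lemma sD k x y : s k (x + y) = s k x * co k y + co k x * s k y.
Proof.
rewrite /s /co; case: ifP => [_|_].
  by rewrite mulrDr sinD; ring.
case: ifP => [_|_]; first by ring.
by rewrite mulrDr sinhD; ring.
Qed.

Lemma sN k x : s k (- x) = - s k x.
Proof.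
by rewrite /s; case: ifP => _; last case: ifP => // _;
  rewrite mulrN ?sinN ?sinhN mulNr.
Qed.

Lemma coN k x : co k (- x) = co k x.
Proof.
by rewrite /co; case: ifP => _; last case: ifP => // _;
  rewrite mulrN ?cosN ?coshN.
Qed.

Lemma co2Ds2 k x : co k x ^+ 2 + k * s k x ^+ 2 = 1.
Proof.
rewrite /s /co; case: ifPn => [k0|kn0].
  have e : k = Num.sqrt k ^+ 2 by rewrite sqr_sqrtr// ltW.
  rewrite -(cos2Dsin2 (Num.sqrt k * x)) [X in _ + X * _ = _]e.
  by move: (sin _) (cos _) => u v; field; rewrite sqrtr_eq0 -ltNge.
case: eqVneq => [->|k_neq0]; first by rewrite expr1n mul0r addr0.
have k0 : 0 < - k by rewrite oppr_gt0 lt_neqAle k_neq0 leNgt.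
have e : k = - Num.sqrt (- k) ^+ 2 by rewrite sqr_sqrtr ?opprK// ltW.
rewrite -(cosh2Bsinh2 (Num.sqrt (- k) * x)) [X in _ + X * _ = _]e.
by move: (sinh _) (cosh _) => u v; field; rewrite sqrtr_eq0 -ltNge.
Qed.

(** After the addition formula is expanded, the two terms containing [co k d] cancel. *)
Lemma s_eq k (a b d : R) :
  s k (a + b) * s k d = s k (a + d) * s k b + s k (d - b) * s k a.
Proof.
by rewrite !sD sN coN; ring.
Qed.

Lemma is_derive_s k x : is_derive x (1 : R) (s k) (co k x).
Proof.
rewrite /s /co; case: ifPn => [k0|kn0].
  apply: trigger_derive; rewrite /GRing.scale/=.
  by field; rewrite sqrtr_eq0 -ltNge.
case: eqVneq => [_|k_neq0]; first exact: is_derive_id.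
have k0 : 0 < - k by rewrite oppr_gt0 lt_neqAle k_neq0 leNgt.
rewrite /sinh /cosh; apply: trigger_derive; rewrite /GRing.scale/=.
move: (expR _) (expR _) => u v; by field; rewrite sqrtr_eq0 -ltNge.
Qed.

Lemma is_derive_co k x : is_derive x (1 : R) (co k) (- k * s k x).
Proof.
rewrite /s /co; case: ifPn => [k0|kn0].
  apply: trigger_derive; rewrite /GRing.scale/=.
  have e : k = Num.sqrt k ^+ 2 by rewrite sqr_sqrtr// ltW.
  rewrite [X in _ = - X * _]e; move: (sin _) => u.
  by field; rewrite sqrtr_eq0 -ltNge.
case: eqVneq => [->|k_neq0]; first by rewrite oppr0 mul0r; exact: is_derive_cst.
have k0 : 0 < - k by rewrite oppr_gt0 lt_neqAle k_neq0 leNgt.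
rewrite /sinh /cosh; apply: trigger_derive; rewrite /GRing.scale/=.
have e : - k = Num.sqrt (- k) ^+ 2 by rewrite sqr_sqrtr// ltW.
rewrite [X in _ = X * _]e.
move: (expR _) (expR _) => u v; by field; rewrite sqrtr_eq0 -ltNge.
Qed.

End model.

(** * Algebra of the functional equation, cleared of denominators *)

Definition sine_eq (R : realType) (f : R -> R) :=
  forall a b d : R, f d != 0 -> f (a + b) * f d = f (a + d) * f b + f (d - b) * f a.

Section sine_equation.
Context {R : realType} {f : R -> R} {d : R}.
Hypotheses (feq : sine_eq R f) (fd : f d != 0).

Lemma sine_eq0 : f 0 = 0.
Proof.
have := feq 0 0 _ fd; rewrite !add0r subr0 => /eqP.
by rewrite mulrC addrC -subr_eq subrr eq_sym mulf_eq0 (negPf fd)/= => /eqP.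
Qed.

(** Putting [a = - d] relates [f (y - d)] to [f (d - y)] by the factor [f (- d) / f d], whose square
    is 1. So [f] is even or odd, and evenness is contradictory. *)
Lemma sine_eq_odd x : f (- x) = - f x.
Proof.
have fN y : f (y - d) * f d = f (d - y) * f (- d).
  by have := feq (- d) y _ fd; rewrite addNr sine_eq0 mul0r add0r addrC.
have fNd : f (- d) ^+ 2 = f d ^+ 2.
  have := fN (d + d); rewrite addrK opprD addrA subrr add0r.
  by rewrite !expr2.
have [fNd_eq|fNd_eq] : f (- d) = f d \/ f (- d) = - f d.
  by move/eqP: fNd; rewrite eqf_sqr => /orP[] /eqP ->; [left|right].
(* For even [f], the arguments [- (d / 2)] and [d / 2] give [f (d / 2) = 0]; then [a = b = d / 2]
   gives [f d * f d = 0]. *)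
- have even y : f (- y) = f y.
    have := fN (d - y); rewrite fNd_eq => /(mulIf fd).
    by rewrite addrAC subrr add0r opprB addrCA subrr addr0.
  have := feq (d / 2) (d / 2) _ fd.
  have := feq (- (d / 2)) (d / 2) _ fd.
  rewrite addNr sine_eq0 mul0r even -mulrDl.
  rewrite (_ : d - d / 2 = d / 2); last by field.
  rewrite (_ : - (d / 2) + d = d / 2); last by field.
  rewrite (_ : d / 2 + d / 2 = d); last by field.
  move=> /esym/eqP; rewrite mulf_eq0 => /orP[|/eqP ->].
    by rewrite -mulr2n mulrn_eq0/= => /eqP ->; rewrite mulr0 mul0r addr0 => /eqP;
      rewrite mulf_eq0 (negPf fd).
  by rewrite !mulr0 addr0 => /eqP; rewrite mulf_eq0 (negPf fd).
- have := fN (d + x); rewrite fNd_eq mulrN -mulNr => /(mulIf fd).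
  by rewrite (addrC d) addrK opprD addrCA subrr addr0 => ->; rewrite opprK.
Qed.

(** When [f] is a multiple of [s k], this is [co k], whatever the choice of [d]. *)
Definition cosine (a : R) : R := (f (d + a) + f (d - a)) / (2 * f d).
Local Notation g := cosine.

Lemma cosine0 : g 0 = 1.
Proof. by rewrite /g addr0 subr0; field. Qed.

Lemma cosineN a : g (- a) = g a.
Proof. by rewrite /g opprK addrC. Qed.

(** Add the equations for [a] and [- a]: by oddness the terms in [f (d - b)] cancel. *)
Lemma wilson a b : f (b + a) + f (b - a) = 2 * f b * g a.
Proof.
have h1 := feq a b _ fd; have h2 := feq (- a) b _ fd.
rewrite sine_eq_odd in h2.
apply: (mulIf fd); rewrite mulrDl (addrC b) h1 (addrC b) h2 (addrC a d).
by rewrite (addrC (- a) d) /g; field.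
Qed.

(** Add [wilson] to itself with [a] and [b] exchanged; the difference terms cancel by oddness. *)
Lemma sine_addition a b : f (a + b) = f a * g b + g a * f b.
Proof.
have h1 := wilson b a; have := wilson a b.
rewrite -(opprB a b) sine_eq_odd (addrC b a) => h2.
lra.
Qed.

(** Expanding [f (d + b + c)] in two ways shows that [g (b + c) - g b * g c] is [f c] times a
    function [K b]. Symmetry in the two arguments then makes [K] a multiple of [f]. *)
Lemma cosine_addition :
  exists kap, forall a b, g (a + b) = g a * g b + kap * (f a * f b).
Proof.
pose K b := (g (d + b) - g d * g b) / f d.
have gK b c : g (b + c) - g b * g c = f c * K b.
  have h1 := sine_addition d (b + c); have h2 := sine_addition (d + b) c.
  rewrite addrA h2 !sine_addition in h1.
  apply: (mulfI fd); rewrite /K.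
  rewrite [RHS](_ : _ = f c * (g (d + b) - g d * g b)); last by field.
  lra.
exists (K d / f d) => a b.
have := gK a b; have := gK d a; have := gK a d.
rewrite (addrC a d) (mulrC (g a) (g d)) => -> Ka.
have -> : K d / f d * (f a * f b) = f b * K a.
  have -> : K a = f a * K d / f d by rewrite -Ka mulrAC divff// mul1r.
  by ring.
by move=> <-; ring.
Qed.

End sine_equation.

(** * Continuity of measurable solutions *)

Section regularity.
Context {R : realType} {f : R -> R} {d : R}.
Hypotheses (mf : lebesgue_measurable_fun f) (feq : sine_eq R f) (fd : f d != 0).
Local Notation mu := (@lebesgue_measure R).
Local Notation g := (@cosine R f d).

(** Shrink [P] for [f], translate the result by [d], shrink again for [f], and translate back. *)
Lemma lebesgue_measurable_oscillation2 (P : set R) (e : R) :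
  measurable P -> (0 < mu P)%E -> 0 < e ->
  exists Q : set R, [/\ measurable Q, Q `<=` P, (0 < mu Q)%E &
    forall x y, Q x -> Q y -> `|f x - f y| <= e /\ `|f (d + x) - f (d + y)| <= e].
Proof.
move=> mP P0 e0.
have mshift (c : R) (A : set R) : measurable A -> measurable (+%R c @^-1` A).
  by move=> mA; have := measurable_addr c measurableT _ mA; rewrite setTI.
have [Q1 [mQ1 Q1P Q10 Q1f]] := lebesgue_measurable_oscillation f P e mf mP P0 e0.
have [|Q2 [mQ2 Q2Q Q20 Q2f]] := lebesgue_measurable_oscillation f
    (+%R (- d) @^-1` Q1) e mf (mshift (- d) _ mQ1) _ e0.
  by rewrite lebesgue_measureD.
have Q21 x : Q2 (d + x) -> Q1 x by move=> /Q2Q /=; rewrite addKr.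
exists (+%R d @^-1` Q2); split; first exact: mshift.
- by move=> x /Q21 /Q1P.
- by rewrite lebesgue_measureD.
- by move=> x y Qx Qy; split; [apply: Q1f; exact: Q21|exact: Q2f].
Qed.

Lemma sine_eq_cvg0 : f x @[x --> (0 : R)] --> (0 : R).
Proof.
apply/cvgr0Pnorm_le => e e0.
have [||P [mP _ P0 Pf]] := @lebesgue_measurable_oscillation2 `[0, 1]%classic 1 _ _ ltr01.
- exact: measurable_itv.
- by rewrite lebesgue_measure_itv/= lte_fin ltr01 oppr0 adde0 lte_fin.
have [x0 Px0] : exists x, P x.
  apply/set0P; apply/negP => /eqP P_eq0.
  by move: P0; rewrite P_eq0 measure0 ltxx.
(* Oscillation at most 1 on [P] makes this a common bound for [f] and [f (d + _)] there. *)
pose M := `|f x0| + `|f (d + x0)| + 1.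
have M0 : 0 < M by rewrite ltr_wpDl// addr_ge0.
have PM x : P x -> `|f x| <= M /\ `|f (d + x)| <= M.
  move=> Px; have [h1 h2] := Pf _ _ Px Px0.
  have := ler_normD (f x - f x0) (f x0).
  have := ler_normD (f (d + x) - f (d + x0)) (f (d + x0)).
  have := normr_ge0 (f x0); have := normr_ge0 (f (d + x0)).
  rewrite !subrK /M => *; lra.
have fd0 : 0 < `|f d| by rewrite normr_gt0.
(* Chosen so that two errors of size [M * e'] add up to [e] times the absolute value of [f d]. *)
pose e' := e * `|f d| / (2 * M).
have e'0 : 0 < e' by rewrite divr_gt0 ?mulr_gt0.
have [Q [mQ QP Q0 Qf]] := lebesgue_measurable_oscillation2 _ _ mP P0 e'0.
have := steinhaus _ mQ Q0; apply: filterS => h [x Qx Qy].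
set y := h + x in Qy; have hE : h = y + - x by rewrite /y addrK.
have [xM xdM] := PM _ (QP _ Qx); have [yM ydM] := PM _ (QP _ Qy).
have [xy xdyd] := Qf _ _ Qx Qy.
rewrite -(ler_pM2r fd0) -normrM hE feq// (sine_eq_odd feq fd) opprK.
(* Inserting [f (d + y) * f y] leaves products of one factor bounded by [M] and one by [e']. *)
rewrite (_ : _ + _ = (f (d + x) - f (d + y)) * f y - f (d + y) * (f x - f y));
  last by rewrite (addrC y); ring.
apply: (le_trans (ler_normB _ _)); rewrite !normrM.
rewrite (_ : e * _ = e' * M + M * e'); last first.
  by rewrite /e'; field; rewrite gt_eqF.
by rewrite lerD// ler_pM.
Qed.

(** The double-angle formula, which carries limits and derivatives at 0 from [f] over to [g]. *)
Lemma cosine_half : exists kap, forall x, g x = 1 + 2 * kap * (f (x / 2) * f (x / 2)).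
Proof.
have [kap gD] := cosine_addition feq fd; exists kap => x.
have := gD (x / 2) (x / 2); have := gD (x / 2) (- (x / 2)).
rewrite subrr (cosine0 fd) (@cosineN R f d) (sine_eq_odd feq fd) -splitr; lra.
Qed.

Lemma sine_eq_continuous : continuous f.
Proof.
move=> x.
have [kap gE] := cosine_half.
have sub0 : y - x @[y --> x] --> (0 : R).
  by rewrite -(subrr x); apply: cvgB => //; exact: cvg_cst.
have g1 : g h @[h --> (0 : R)] --> (1 : R).
  rewrite [X in X @ _](_ : _ =
    fun h => 1 + 2 * kap * (f (h / 2) * f (h / 2))); last exact/funext.
  have h2 : h / 2 @[h --> (0 : R)] --> (0 : R).
    by rewrite -[X in _ --> X](mul0r 2^-1); apply: cvgMl; exact: cvg_id.
  have f2 := cvg_comp _ _ h2 sine_eq_cvg0.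
  rewrite -[X in _ --> X](_ : 1 + 2 * kap * (0 * 0) = 1); last by ring.
  apply: cvgD; first exact: cvg_cst.
  by apply: cvgMr; apply: cvgM.
have fx := cvg_comp _ _ sub0 sine_eq_cvg0.
have gx := cvg_comp _ _ sub0 g1.
suff : f y @[y --> x] --> f x by [].
rewrite [X in X @ _](_ : _ = fun y => f x * g (y - x) + g x * f (y - x)); last first.
  by apply/funext => y; rewrite -(sine_addition feq fd) addrC subrK.
rewrite -[X in _ --> X](_ : f x * 1 + g x * 0 = f x); last by rewrite mulr1 mulr0 addr0.
by apply: cvgD; apply: cvgMr.
Qed.

End regularity.

(** * Calculus on bounded intervals *)

Lemma continuous_primitive {R : realType} (f : R -> R) (a b : R) :
  continuous f ->
  exists F : R -> R, forall x, a < x < b -> is_derive x (1 : R) F (f x).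
Proof.
move=> cf.
exists (fun x => (\int[lebesgue_measure]_(t in [set` `[a, x]]) f t)%R) => x /andP[ax xb].
have intf : lebesgue_measure.-integrable [set` `[a, b]] (EFin \o f).
  apply: continuous_compact_integrable; first exact: segment_compact.
  exact: continuous_subspaceT.
have [dF FE] := continuous_FTC1_closed xb intf ax (cf x).
by apply: DeriveDef => //; rewrite -derive1E.
Qed.

Lemma is_derive0_itv_cst {R : realType} (f : R -> R) (a b : R) :
  (forall x, a < x < b -> is_derive x (1 : R) f 0) ->
  forall x y, a < x < b -> a < y < b -> f x = f y.
Proof.
move=> df x y.
wlog xy : x y / x <= y => [wlg xab yab|/andP[ax xb] /andP[ay yb]].
  by case: (leP x y) => [xy|/ltW yx]; [exact: wlg|apply/esym; exact: wlg].
have [| |c _] := @MVT_segment R f (fun=> 0) x y xy.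
- move=> z; rewrite in_itv/= => /andP[xz zy]; apply: df.
  by rewrite (lt_trans ax)// (lt_trans zy).
- apply: derivable_within_continuous => z; rewrite in_itv/= => /andP[xz zy].
  suff /@ex_derive : is_derive z (1 : R) f 0 by [].
  by apply: df; rewrite (lt_le_trans ax)// (le_lt_trans zy).
- by rewrite mul0r => /eqP; rewrite subr_eq0 => /eqP.
Qed.

(** * Differentiability and the linear differential system *)

Section smoothness.
Context {R : realType} {f : R -> R} {d : R}.
Hypotheses (mf : lebesgue_measurable_fun f) (feq : sine_eq R f) (fd : f d != 0).
Local Notation g := (@cosine R f d).

Lemma sine_eq_is_derive0 : exists c, is_derive (0 : R) (1 : R) f c.
Proof.
(* Large enough that [b + t] and [b - t] stay in the domain of the primitive for [t] in []- 2, 2[]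
   and [b] either [d] or in []- 2, 2[]. *)
pose N : R := `|d| + 4; have N4 : 4 <= N by rewrite /N lerDr.
have near2 : \forall t \near (0 : R), - 2 < t < 2.
  have /near_in_itvoo : (0 : R) \in `]- 2, 2[ by rewrite in_itv/=; lra.
  by apply: filterS => t; rewrite in_itv.
have dN : - N + 2 <= d <= N - 2.
  have := ler_norm d; have := ler_norm (- d); rewrite normrN /N => *; lra.
have [F dF] := continuous_primitive f (- N) N (sine_eq_continuous mf feq fd).
have dFD (b t : R) : - N < b + t < N ->
    is_derive t (1 : R) (fun t => F (b + t)) (f (b + t)).
  move=> /dF dFbt.
  rewrite -[f (b + t)]mulr1.
  apply: (@is_derive1_comp R F (fun t => b + t)).
  by apply: trigger_derive; rewrite /GRing.scale/=; ring.
have dFB (b t : R) : - N < b - t < N ->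
    is_derive t (1 : R) (fun t => F (b - t)) (- f (b - t)).
  move=> /dF dFbt.
  rewrite -mulrN1.
  apply: (@is_derive1_comp R F (fun t => b - t)).
  by apply: trigger_derive; rewrite /GRing.scale/=; ring.
pose G b t := F (b + t) - F (b - t).
have dG (b t : R) : - N + 2 <= b <= N - 2 -> - 2 < t < 2 ->
    is_derive t (1 : R) (G b) (2 * f b * g t).
  move=> bN t2.
  rewrite -(wilson feq fd) -[f (b - t)]opprK.
  by apply: is_deriveB; [apply: dFD; lra|apply: dFB; lra].
have G0 b : G b 0 = 0 by rewrite /G addr0 subr0 subrr.
(* Both sides vanish at [t = 0] and have the derivative [2 * f d * f b * g t]. *)
have GE (b t : R) : - N + 2 <= b <= N - 2 -> - 2 < t < 2 -> f d * G b t = f b * G d t.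
  move=> bN t2; apply/eqP; rewrite -subr_eq0; apply/eqP.
  transitivity (f d * G b 0 - f b * G d 0); last by rewrite !G0 !mulr0 subrr.
  apply: (@is_derive0_itv_cst R (fun t => f d * G b t - f b * G d t) (- 2) 2);
    [|by []|by lra].
  move=> x x2; have dGb := dG _ _ bN x2; have dGd := dG _ _ dN x2.
  by apply: trigger_derive; rewrite /GRing.scale/=; ring.
(* Otherwise the derivative of [G d] at 0 would vanish, but it equals [2 * f d]. *)
have [t0 t02 Gt0] : exists2 t0, - 2 < t0 < 2 & G d t0 != 0.
  apply: contrapT => /forall2NP noG.
  have : is_derive (0 : R) (1 : R) (G d) 0.
    apply: (@near_eq_is_derive _ _ _ (cst 0)).
    apply: filterS near2 => t t2; apply/esym/eqP/negPn/negP => Gt.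
    by have [|] := noG t.
  move=> [_ dG0]; have [|_ dG1] := dG d 0 dN; first by lra.
  have /eqP := etrans (esym dG1) dG0; rewrite (cosine0 fd) mulr1.
  by rewrite mulf_eq0 (negPf fd) orbF pnatr_eq0.
exists (f d / G d t0 * (f t0 - f (- t0))).
apply: (@near_eq_is_derive _ _ _ (fun b => f d / G d t0 * G b t0)).
  apply: filterS near2 => b b2; rewrite -[RHS](mulfK Gt0) -GE//; last by lra.
  by rewrite mulrAC.
have dFs (u : R) : - 2 < u < 2 -> is_derive (0 : R) (1 : R) (fun b => F (b + u)) (f u).
  move=> u2; rewrite -(mulr1 (f u)).
  apply: (@is_derive1_comp R F (fun b => b + u)); first by rewrite add0r; apply: dF; lra.
  by apply: trigger_derive; rewrite /GRing.scale/=; ring.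
have dF1 := dFs t0 t02.
have dF2 : is_derive (0 : R) (1 : R) (fun b => F (b - t0)) (f (- t0)).
  by apply: dFs; lra.
by apply: trigger_derive; rewrite /GRing.scale/=; ring.
Qed.

Lemma sine_eq_is_derive : exists kap c, forall x,
  is_derive x (1 : R) f (c * g x) /\ is_derive x (1 : R) g (kap * c * f x).
Proof.
have [c df0] := sine_eq_is_derive0.
have [kap gD] := cosine_addition feq fd.
have [kap' gE] := cosine_half feq fd.
(* By [cosine_half], [g] is a constant plus a multiple of a square that vanishes to second order, as
   [f 0 = 0]. *)
have dg0 : is_derive (0 : R) (1 : R) g 0.
  rewrite [X in is_derive _ _ X](_ : _ =
    fun h => 1 + 2 * kap' * (f (h / 2) * f (h / 2))); last exact/funext.
  have dh : is_derive (0 : R) (1 : R) (fun h => f (h / 2)) (c * 2^-1).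
    apply: (@is_derive1_comp R f (fun h => h / 2)); first by rewrite mul0r.
    by apply: trigger_derive; rewrite /GRing.scale/=; ring.
  by apply: trigger_derive; rewrite /GRing.scale/= mul0r (sine_eq0 feq fd); ring.
have sub (u : R -> R) (x l : R) : is_derive (0 : R) (1 : R) u l ->
    is_derive x (1 : R) (fun y => u (y - x)) l.
  rewrite -(subrr x) => du; rewrite -(mulr1 l).
  apply: (@is_derive1_comp R u (fun y => y - x)).
  by apply: trigger_derive; rewrite /GRing.scale/=; ring.
exists kap, c => x.
have dfx := sub f x _ df0; have dgx := sub g x _ dg0.
split.
- rewrite [X in is_derive _ _ X](_ : _ = fun y => f x * g (y - x) + g x * f (y - x)).
    by apply: trigger_derive; rewrite /GRing.scale/=; ring.
  by apply/funext => y; rewrite -(sine_addition feq fd) addrC subrK.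
- rewrite [X in is_derive _ _ X](_ : _ =
    fun y => g x * g (y - x) + kap * (f x * f (y - x))).
    by apply: trigger_derive; rewrite /GRing.scale/=; ring.
  by apply/funext => y; rewrite -gD addrC subrK.
Qed.

(** Uniqueness for the linear system comes from two first integrals, [phi] and [chi], evaluated at
    0. Solving them for [f x] has determinant [co k x ^+ 2 + k * s k x ^+ 2 = 1]. *)
Lemma sine_eq_s : calS f.
Proof.
have [kap [c dfg]] := sine_eq_is_derive.
pose k := - (kap * c ^+ 2); exists c, k; apply/funext => x.
have df y := (dfg y).1; have dg y := (dfg y).2.
have ds := @is_derive_s R k; have dc := @is_derive_co R k.
have f0 := sine_eq0 feq fd; have g0 := @cosine0 R f d fd.
have s0 : s k 0 = 0.
  by have /eqP := sN k (0 : R); rewrite oppr0 -addr_eq0 -mulr2n mulrn_eq0 => /eqP.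
have c0 : co k (0 : R) = 1.
  by rewrite /co !mulr0 cos0 /cosh oppr0 expR0; do 2 case: ifP => // _; field.
have phi : f x * co k x - c * g x * s k x = 0.
  transitivity (f 0 * co k 0 - c * g 0 * s k 0); last by rewrite f0 s0 mul0r mulr0 subrr.
  apply: (@is_derive_0_is_cst R (fun x => f x * co k x - c * g x * s k x)) => y.
  by apply: trigger_derive; rewrite /GRing.scale/= /k; ring.
have chi : c * g x * co k x + k * f x * s k x = c.
  transitivity (c * g 0 * co k 0 + k * f 0 * s k 0); last first.
    by rewrite g0 c0 s0 !mulr1 mulr0 addr0.
  apply: (@is_derive_0_is_cst R (fun x => c * g x * co k x + k * f x * s k x)) => y.
  by apply: trigger_derive; rewrite /GRing.scale/= /k; ring.
rewrite -[LHS]mulr1 -(co2Ds2 k x) -[in RHS]chi.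
have -> : f x * (co k x ^+ 2 + k * s k x ^+ 2) =
  co k x * (f x * co k x - c * g x * s k x) +
  (c * g x * co k x + k * f x * s k x) * s k x.
  by ring.
by rewrite phi mulr0 add0r.
Qed.

End smoothness.

Theorem theorem3p1 (R : realType) (f : R -> R)
    (mf : lebesgue_measurable_fun f) :
  (forall alpha beta delta : R, (~` (f @^-1` [set 0])) delta ->
     f (alpha + beta) = f (alpha + delta) / f delta * f beta
                        + f (delta - beta) / f delta * f alpha)
  <-> calS f.
Proof.
split=> [feq|[c [k ->]] a b d /= /eqP]; last first.
  rewrite mulf_eq0 negb_or => /andP[c0 s0].
  by apply: (mulIf s0); rewrite -[LHS]mulrA s_eq; field; rewrite s0 c0.
have [[d fd]|f0] := pselect (exists d, f d != 0).
  apply: (@sine_eq_s R f d) => // a b e /[dup] fe /eqP fe0.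
  by rewrite (feq _ _ _ fe0); field.
(* No admissible [d] exists, so [f] is the zero function, taken as [0 * s 0 x]. *)
exists 0, 0; apply/funext => x; rewrite mul0r; apply/eqP/negPn/negP => fx.
by apply: f0; exists x.
Qed.
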